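(* Let $n\ge5$ be odd. Let $D,H,G$ be the test semirings defined in the context and $\mathcal W$ the variety generated by $\{H,D,G\}$. For distinct variables $x_1,\ldots,x_n,y_1,\ldots,y_n,z$ (with $y_{n+1}=y_1$), consider in the free commutative ai-semiring \[ p_n=x_1x_2\cdots x_n,\quad a_n=x_1z,\quad q_n=p_nz,\quad b_i=x_iy_iy_{i+1}z\ (1\le i\le n),\quad U_n=p_n+a_n+\sum_{i=1}^n b_i . \] If $r$ is a commutative word such that $\mathcal W\models U_n+r\approx U_n$, then \[ r\in\{p_n,a_n,b_1,\ldots,b_n,q_n\}. \] Moreover, the equivalence class of $U_n$ under the identities of $\mathcal W$ in the free commutative ai-semiring, that is, the set of all polynomials $v$ with $\mathcal W\models v\approx U_n$, is exactly $\{U_n,\;U_n+q_n\}$.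
   Context: A semiring is a nonempty algebra $(S,+,\cdot)$ (no constants) in which both operations are associative and multiplication distributes over addition on both sides. An ai-semiring is a semiring whose addition is commutative and idempotent; it is commutative if its multiplication is commutative as well. Let $X$ be a countably infinite set of variables (containing all those used) and $X_c^+$ the free commutative semigroup on $X$; its elements are called commutative words (nonempty, determined by the multiplicity of each variable). A polynomial is a finite nonempty subset of $X_c^+$, written as the formal sum of its words. With union as addition and setwise multiplication of words as product, polynomials form the free commutative ai-semiring on $X$. Test semirings (element names are labels, not constants). $D=\{0,1\}$ is the two-element distributive lattice, with join as addition and meet as multiplication. $H=\{1,a,\infty\}$ has addition equal to the join in the chain $1<a<\infty$, and its commutative multiplication has identity $1$, $a\cdot a=\infty$, and $\infty$ absorbing. $G=\{1,g,\infty\}$ has addition $x+x=x$ and $x+y=\infty$ for $x\ne y$, and its commutative multiplication has identity $1$, $g\cdot g=1$, and $\infty$ absorbing. All three are commutative ai-semirings. *)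

(* Defs.v *)
(* Mathematical Components, with finmap for finite sets and multisets *)
From HB Require Import structures.
From mathcomp Require Import all_boot finmap multiset.

Set Implicit Arguments.
Unset Strict Implicit.
Unset Printing Implicit Defensive.

Local Open Scope fset_scope.
Local Open Scope mset_scope.

(* No constants are part of the signature, so MathComp's semirings, which have
   0 and 1, do not apply. *)
HB.mixin Record isComAISemiring (S : Type) := {
  add : S -> S -> S;
  mul : S -> S -> S;
  carrier_nonempty : inhabited S;
  addA : associative add;
  addC : commutative add;
  addxx : idempotent_op add;
  mulA : associative mul;
  mulC : commutative mul;
  mulDl : left_distributive mul add;
  mulDr : right_distributive mul add
}.

#[short(type="comAISemiringType")]
HB.structure Definition ComAISemiring := {S of isComAISemiring S}.

Definition hom (S T : comAISemiringType) (f : S -> T) : Prop :=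
  {morph f : a b / add a b} /\ {morph f : a b / mul a b}.

(* P with the projections pr is, up to isomorphism, the direct product of the
   family S; the index type I is arbitrary, possibly empty or infinite. *)
Definition is_product (I : Type) (S : I -> comAISemiringType)
    (P : comAISemiringType) (pr : forall i, P -> S i) : Prop :=
  (forall i, hom (pr i)) /\
  (forall s : (forall i, S i), exists! t : P, forall i, pr i t = s i).

(* Every algebra generated from commutative ai-semirings by H, S and P is again
   one, so restricting classes to commutative ai-semirings loses nothing. *)
Record is_variety (V : comAISemiringType -> Prop) : Prop := {
  variety_sub : forall (S T : comAISemiringType) (f : T -> S),
    hom f -> injective f -> V S -> V T;
  variety_im : forall (S T : comAISemiringType) (f : S -> T),
    hom f -> (forall t, exists s, f s = t) -> V S -> V T;
  variety_prod : forall (I : Type) (S : I -> comAISemiringType)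
      (P : comAISemiringType) (pr : forall i, P -> S i),
    is_product pr -> (forall i, V (S i)) -> V P
}.

Definition generated_variety (K : comAISemiringType -> Prop)
    (S : comAISemiringType) : Prop :=
  forall V, is_variety V -> (forall T, K T -> V T) -> V S.

Definition var := nat.

(* Elements of the free commutative monoid on var; the commutative words are
   the nonempty ones. *)
Definition word := {mset var}.
Definition is_cword (w : word) : bool := w != mset0.

Definition is_polynomial (u : {fset word}) : bool :=
  (u != fset0) && [forall w : u, is_cword (val w)].

(* The value of a polynomial under an assignment of the variables.  As there is
   no 0 and no 1, sums and products are iterated in option S, with None as the
   empty sum and the empty product: on polynomials the value is Some _. *)
Definition eval (S : comAISemiringType) (phi : var -> S) (u : {fset word}) :
    option S :=
  \big[oAC (@addA S) (@addC S) / None]_(w <- u)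
    \big[oAC (@mulA S) (@mulC S) / None]_(t <- enum_mset w) Some (phi t).

Definition satisfies (S : comAISemiringType) (u v : {fset word}) : Prop :=
  forall phi : var -> S, eval phi u = eval phi v.

Definition class_satisfies (K : comAISemiringType -> Prop)
    (u v : {fset word}) : Prop :=
  forall S, K S -> satisfies S u v.

Definition D := bool.

Fact D_nonempty : inhabited D. Proof. exact: (inhabits true). Qed.
Fact D_addA : associative (orb : D -> D -> D). Proof. exact: orbA. Qed.
Fact D_addC : commutative (orb : D -> D -> D). Proof. exact: orbC. Qed.
Fact D_addxx : idempotent_op (orb : D -> D -> D). Proof. by case. Qed.
Fact D_mulA : associative (andb : D -> D -> D). Proof. exact: andbA. Qed.
Fact D_mulC : commutative (andb : D -> D -> D). Proof. exact: andbC. Qed.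
Fact D_mulDl : left_distributive (andb : D -> D -> D) orb.
Proof. by case; case; case. Qed.
Fact D_mulDr : right_distributive (andb : D -> D -> D) orb.
Proof. by case; case; case. Qed.

HB.instance Definition _ := isComAISemiring.Build D
  D_nonempty D_addA D_addC D_addxx D_mulA D_mulC D_mulDl D_mulDr.

Inductive H : Set := H_one | H_a | H_inf.

Definition H_add (s t : H) : H :=
  match s, t with
  | H_inf, _ | _, H_inf => H_inf
  | H_a, _ | _, H_a => H_a
  | H_one, H_one => H_one
  end.

Definition H_mul (s t : H) : H :=
  match s, t with
  | H_one, u | u, H_one => u
  | _, _ => H_inf
  end.

Fact H_nonempty : inhabited H. Proof. exact: (inhabits H_one). Qed.
Fact H_addA : associative H_add. Proof. by case; case; case. Qed.
Fact H_addC : commutative H_add. Proof. by case; case. Qed.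
Fact H_addxx : idempotent_op H_add. Proof. by case. Qed.
Fact H_mulA : associative H_mul. Proof. by case; case; case. Qed.
Fact H_mulC : commutative H_mul. Proof. by case; case. Qed.
Fact H_mulDl : left_distributive H_mul H_add. Proof. by case; case; case. Qed.
Fact H_mulDr : right_distributive H_mul H_add. Proof. by case; case; case. Qed.

HB.instance Definition _ := isComAISemiring.Build H
  H_nonempty H_addA H_addC H_addxx H_mulA H_mulC H_mulDl H_mulDr.

Inductive G : Set := G_one | G_g | G_inf.

Definition G_add (s t : G) : G :=
  match s, t with
  | G_one, G_one => G_one
  | G_g, G_g => G_g
  | _, _ => G_inf
  end.

Definition G_mul (s t : G) : G :=
  match s, t with
  | G_one, u | u, G_one => u
  | G_g, G_g => G_one
  | _, _ => G_inf
  end.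

Fact G_nonempty : inhabited G. Proof. exact: (inhabits G_one). Qed.
Fact G_addA : associative G_add. Proof. by case; case; case. Qed.
Fact G_addC : commutative G_add. Proof. by case; case. Qed.
Fact G_addxx : idempotent_op G_add. Proof. by case. Qed.
Fact G_mulA : associative G_mul. Proof. by case; case; case. Qed.
Fact G_mulC : commutative G_mul. Proof. by case; case. Qed.
Fact G_mulDl : left_distributive G_mul G_add. Proof. by case; case; case. Qed.
Fact G_mulDr : right_distributive G_mul G_add. Proof. by case; case; case. Qed.

HB.instance Definition _ := isComAISemiring.Build G
  G_nonempty G_addA G_addC G_addxx G_mulA G_mulC G_mulDl G_mulDr.

Definition test_semirings (S : comAISemiringType) : Prop :=
  [\/ S = (H : comAISemiringType), S = (D : comAISemiringType)
    | S = (G : comAISemiringType)].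

Definition W : comAISemiringType -> Prop := generated_variety test_semirings.

(* Indices run from 1 to n; only the values x 1, ..., x n, y 1, ..., y n.+1 of
   the families x and y are used. *)
Definition p_word (n : nat) (x : nat -> var) : word :=
  seq_mset [seq x i | i <- iota 1 n].

Definition a_word (x : nat -> var) (z : var) : word :=
  seq_mset [:: x 1; z].

Definition q_word (n : nat) (x : nat -> var) (z : var) : word :=
  p_word n x `+` [mset z].

Definition b_word (x y : nat -> var) (z : var) (i : nat) : word :=
  seq_mset [:: x i; y i; y i.+1; z].

Definition U (n : nat) (x y : nat -> var) (z : var) : {fset word} :=
  ([fset p_word n x; a_word x z]
     `|` [fset b_word x y z i | i in iota 1 n])%fset.

(* Main.v *)
(* Membership in a generated variety preserves identities, so the identities of W between
   polynomials are those valid in D, H and G.  If U_n + r and U_n agree, then D forces r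
   to contain a word of U_n, H forces r to be multilinear with any two of its letters
   occurring together in a word of U_n, and G forces r to meet a set of letters an even
   number of times whenever all words of U_n do.  A clique above p_n or b_i cannot be much
   larger; above a_n, parity on all the y_i leaves b_1 or no y at all, and then parity on
   {x_i, x_(i+1), y_(i+1)}, 2 <= i < n, makes x_2, ..., x_n occur together or not at all.
   Conversely U_n absorbs q_n: in G this holds because n is odd and
   b_1 ... b_n = p_n (y_1 ... y_n)^2 z^n. *)
From HB Require Import structures.
Require Import Defs.
From mathcomp Require Import all_boot finmap multiset.
From mathcomp Require Import zify.
From Stdlib Require Import IndefiniteDescription.

Set Implicit Arguments.
Unset Strict Implicit.
Unset Printing Implicit Defensive.

Local Open Scope fset_scope.

(** * Evaluation of words and polynomials *)

Local Notation oadd S := (oAC (@addA S) (@addC S)).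
Local Notation omul S := (oAC (@mulA S) (@mulC S)).

Definition weval (S : comAISemiringType) (phi : var -> S) (w : word) : option S :=
  \big[omul S / None]_(t <- enum_mset w) Some (phi t).

Lemma in_fsetU1_r (u : {fset word}) (r w : word) :
  (w \in u `|` [fset r]) = (w \in u) || (w == r).
Proof. by rewrite !inE. Qed.

Lemma is_polynomialP (u : {fset word}) w :
  w \in u -> {in u, forall v, is_cword v} -> is_polynomial u.
Proof.
move=> wu uP; apply/andP; split; first by apply/fset0Pn; exists w.
by apply/forallP => v; apply/uP/fsvalP.
Qed.

Section Evaluation.

Variables (S : comAISemiringType) (phi : var -> S).

Lemma evalE u : eval phi u = \big[oadd S / None]_(w <- u) weval phi w.
Proof. by []. Qed.

Lemma oaddxx : idempotent_op (oadd S).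
Proof. by case=> // s; rewrite oACE addxx. Qed.

(** Addition is idempotent, so the sum depends only on the set of summands, and [r] may already lie
    in [u]. *)
Lemma eval_setU1 u r : eval phi (u `|` [fset r]) = oadd S (weval phi r) (eval phi u).
Proof.
rewrite !evalE (@eq_big_idem _ _ _ _ _ (r :: u)) ?big_cons //; first exact: oaddxx.
by move=> w; rewrite !inE orbC.
Qed.

Lemma eval_absorb u w : w \in u -> oadd S (weval phi w) (eval phi u) = eval phi u.
Proof.
move=> wu; rewrite -eval_setU1; congr eval.
by apply/fsetUidPl; rewrite fsub1set.
Qed.

Lemma eval_ind (P : option S -> Prop) u :
  P None -> (forall a b, P a -> P b -> P (oadd S a b)) ->
  (forall w, w \in u -> P (weval phi w)) -> P (eval phi u).
Proof. by move=> P0 PD Pu; rewrite evalE big_seq; apply: big_ind. Qed.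

Lemma weval_seq s : weval phi (seq_mset s) = \big[omul S / None]_(t <- s) Some (phi t).
Proof. exact/perm_big/perm_eq_seq_mset. Qed.

(** All three test semirings have a multiplicative identity. Reading the empty product [None] as
    that identity turns products in [option S] into ordinary ones. *)
Lemma big_unital (e : S) s : left_id e (@Defs.mul S) ->
  odflt e (\big[omul S / None]_(t <- s) Some (phi t)) =
  \big[@Defs.mul S / e]_(t <- s) phi t.
Proof.
move=> e1; apply: (big_morph (odflt e)) => // -[a|] [b|] //=; rewrite ?e1 //.
by rewrite mulC e1.
Qed.

Lemma weval_unital (e : S) w : left_id e (@Defs.mul S) ->
  odflt e (weval phi w) = \big[@Defs.mul S / e]_(t <- enum_mset w) phi t.
Proof. exact: big_unital. Qed.

Lemma weval_seq_unital (e : S) s : left_id e (@Defs.mul S) ->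
  odflt e (weval phi (seq_mset s)) = \big[@Defs.mul S / e]_(t <- s) phi t.
Proof. by rewrite weval_seq; apply: big_unital. Qed.

Lemma isSome_oAC T (op : T -> T -> T) opA opC :
  {morph isSome : a b / @oAC T op opA opC a b >-> a || b}.
Proof. by move=> [a|] [b|]. Qed.

Let isSome_None : isSome (@None S) = false := erefl.

Lemma weval_isSome w : is_cword w -> weval phi w.
Proof.
rewrite /is_cword /weval => w0.
rewrite (big_morph _ (isSome_oAC (op := _) _ _) isSome_None).
have [t tw] : exists t, t \in enum_mset w.
  case E: (enum_mset w) => [|t s]; last by exists t; rewrite mem_head.
  by move: w0; rewrite -(seq_mset_id w) E -enum_mset0 seq_mset_id eqxx.
by rewrite big_has_cond; apply/hasP; exists t.
Qed.

Lemma eval_isSome u : is_polynomial u -> eval phi u.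
Proof.
case/andP=> u0 /forallP uP.
rewrite evalE (big_morph _ (isSome_oAC (op := _) _ _) isSome_None).
have [w wu] := fset0Pn _ u0.
by rewrite big_has_cond; apply/hasP; exists w => //=; apply/weval_isSome/(uP [` wu]).
Qed.

(** In the semilattice order, where [add s c = c] means that [s] lies below [c], the value of a
    polynomial bounds the values of its words. The default [e] is never reached, because [w] is
    nonempty. *)
Lemma eval_upper (e c : S) u w : is_cword w -> w \in u -> eval phi u = Some c ->
  add (odflt e (weval phi w)) c = c.
Proof.
move=> /weval_isSome w0 wu uc; have := eval_absorb wu; rewrite uc.
by case: (weval phi w) w0 => // d _ [].
Qed.

Lemma eval_setU1_id (e c : S) u r : is_cword r -> eval phi u = Some c ->
  add (odflt e (weval phi r)) c = c -> eval phi (u `|` [fset r]) = eval phi u.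
Proof.
move=> /weval_isSome r0 uc; rewrite eval_setU1 uc.
by case: (weval phi r) r0 => // d _ /= rc; rewrite oACE rc.
Qed.

Lemma eval_hom (T : comAISemiringType) (f : S -> T) u :
  hom f -> eval (f \o phi) u = omap f (eval phi u).
Proof.
case=> fD fM; have oM op1 op1A op1C op2 op2A op2C :
    {morph f : a b / op1 a b >-> op2 a b} ->
    {morph omap f : a b / @oAC S op1 op1A op1C a b >-> @oAC T op2 op2A op2C a b}.
  by move=> fop [a|] [b|] //=; rewrite !oACE /= fop.
have oN : omap f None = None by [].
rewrite !evalE (big_morph _ (oM _ _ _ _ (@addA T) (@addC T) fD) oN).
apply: eq_bigr => w _; rewrite /weval.
by rewrite (big_morph _ (oM _ _ _ _ (@mulA T) (@mulC T) fM) oN).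
Qed.

End Evaluation.

(** * Identities in a generated variety *)

Lemma eq_eval (S : comAISemiringType) (phi psi : var -> S) u :
  phi =1 psi -> eval phi u = eval psi u.
Proof.
by move=> E; apply: eq_bigr => w _; apply: eq_bigr => t _; rewrite E.
Qed.

(* Excluding non-polynomials matters for the empty product: in the one-element
   algebra an identity between None and Some _ fails. *)
Lemma satisfies_variety u v : is_polynomial u -> is_polynomial v ->
  is_variety (fun S => satisfies S u v).
Proof.
move=> uP vP.
split=> [S T f fh finj fS phi|S T f fh fsurj fS phi|I S P pr [prh prU] prS phi].
- have := fS (f \o phi); rewrite !(eval_hom _ _ fh).
  exact/inj_omap.
(* A section of [f] lifts the assignment from [T] to [S]. *)
- have [g gK] := functional_choice _ fsurj.
  have fg : phi =1 f \o (g \o phi) by move=> t /=; rewrite gK.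
  by rewrite !(eq_eval _ fg) !(eval_hom _ _ fh) fS.
- have := eval_isSome phi uP; have := eval_isSome phi vP.
  case Eu: (eval phi u) => [a|] //; case Ev: (eval phi v) => [b|] // _ _.
  (* Both [a] and [b] have the coordinates [pr i a], and the element of [P] with these coordinates
     is unique. *)
  have [c [_ cU]] := prU (fun i => pr i a); congr Some.
  rewrite -(cU a) // (cU b) // => i.
  have := prS i (pr i \o phi); rewrite !(eval_hom _ _ (prh i)) Eu Ev.
  by case.
Qed.

Lemma W_satisfies u v : is_polynomial u -> is_polynomial v ->
  class_satisfies W u v <-> [/\ satisfies D u v, satisfies H u v & satisfies G u v].
Proof.
move=> uP vP; split=> [Wuv|[Duv Huv Guv] S WS].
  by split; apply: Wuv => V _; apply; [apply: Or32|apply: Or31|apply: Or33].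
apply: (WS (fun T => satisfies T u v)); first exact: satisfies_variety.
by move=> T [] ->.
Qed.

(** * Necessary conditions for absorption, from D, H and G *)

Lemma D_absorbed_sub (u : {fset word}) (r : word) :
  is_cword r -> satisfies D (u `|` [fset r]) u ->
  exists2 w : word, w \in u & {subset w <= r}.
Proof.
(* Under this assignment a word has value [true] exactly when all its letters lie in [r]. As [r]
   itself does, so must some word of [u]. *)
pose phi : var -> D := fun t => t \in r.
move=> r0 /(_ phi); rewrite eval_setU1 => ur.
have phiE (w : word) : odflt true (weval phi w) = all [in r] (enum_mset w).
  by rewrite -big_all; apply: (@weval_unital D).
have [/hasP[w wu /allP]|/hasPn nw] := boolP (has (fun w => all [in r] (enum_mset w)) u).
  by exists w.
(* An empty sum is read as [false], whereas [phiE] reads an empty product as [true]. *)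
have : odflt false (eval phi u) = false.
  apply: (@eval_ind D phi (fun o => odflt false o = false)) => // [[[]|] [[]|]|w /nw] //.
  by rewrite -phiE; case: weval => [[]|].
have : odflt true (weval phi r) by rewrite phiE; apply/allP.
move: ur (weval_isSome phi r0).
by case: (eval phi u) => [[]|] //; case: (weval phi r) => [[]|].
Qed.

(** The powers of [H_a]. *)
Definition H_of_nat n := match n with 0 => H_one | 1 => H_a | _ => H_inf end.

(** Send the letters of [A] to [H_a] and the others to [H_one]. A word has value [H_inf] exactly
    when it has at least two occurrences of letters of [A], and a join in the chain is [H_inf] only
    if some summand is. *)
Lemma H_absorbed_count (A : pred var) (u : {fset word}) (r : word) :
  satisfies H (u `|` [fset r]) u ->
  1 < count A (enum_mset r) -> exists2 w : word, w \in u & 1 < count A (enum_mset w).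
Proof.
pose phi t := if A t then H_a else H_one.
move=> /(_ phi); rewrite eval_setU1 => ur.
have phiE (w : word) : odflt H_one (weval phi w) = H_of_nat (count A (enum_mset w)).
  rewrite weval_unital //; elim: (enum_mset w) => [|t s IH] /=; first by rewrite big_nil.
  by rewrite big_cons {}IH /phi; case: (A t) (count A s) => [] [|[]].
have [/hasP[w wu wA]|/hasPn nw] := boolP (has (fun w => 1 < count A (enum_mset w)) u).
  by exists w.
pose small (o : option H) := if o is Some H_inf then false else true.
have : small (eval phi u).
  apply: (@eval_ind H phi small).
  - by [].
  - by move=> [[]|] [[]|].
  - by move=> w /nw; have := phiE w; case: count => [|[|n]] //; case: weval => [[]|].
have := phiE r; case: (count A (enum_mset r)) => [|[|n]] //= phir + _.
by move: ur phir; case: (eval phi u) => [[]|]; case: (weval phi r) => [[]|].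
Qed.

(** Send the letters of [A] to [G_g] and the others to [G_one]. If all words of [u] are even on [A],
    their sum is [G_one], and adding a word of value [G_g] would change it to [G_inf]. *)
Lemma G_absorbed_even (A : pred var) (u : {fset word}) (r : word) :
  satisfies G (u `|` [fset r]) u ->
  (forall w : word, w \in u -> ~~ odd (count A (enum_mset w))) ->
  ~~ odd (count A (enum_mset r)).
Proof.
pose phi t := if A t then G_g else G_one.
move=> /(_ phi); rewrite eval_setU1 => ur even_u.
have phiE (w : word) :
    odflt G_one (weval phi w) = if odd (count A (enum_mset w)) then G_g else G_one.
  rewrite weval_unital; last by case.
  elim: (enum_mset w) => [|t s IH] /=; first by rewrite big_nil.
  by rewrite big_cons {}IH /phi oddD; case: (A t); case: (odd (count A s)).
have : odflt G_one (eval phi u) = G_one.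
  apply: (@eval_ind G phi (fun o => odflt G_one o = G_one)).
  - by [].
  - by move=> [[]|] [[]|].
  - by move=> w /even_u/negPf; rewrite phiE => ->.
have := phiE r; case: odd => //.
by move: ur; case: (eval phi u) => [[]|] //; case: (weval phi r) => [[]|].
Qed.

(** * Letters and multiplicities of words *)

Lemma in_seq_mset (t : var) (s : seq var) : (t \in seq_mset s) = (t \in s).
Proof. by rewrite -mset_gt0 mset_seqE -has_count has_pred1. Qed.

Lemma count_seq_mset (A : pred var) s : count A (enum_mset (seq_mset s)) = count A s.
Proof. exact/permP/perm_eq_seq_mset. Qed.

Lemma cword_mem (t : var) (w : word) : t \in w -> is_cword w.
Proof. by move=> tw; apply/eqP => w0; rewrite w0 in_mset0 in tw. Qed.

Lemma eq_seq_mset (r : word) (s : seq var) :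
  (forall t, r t <= 1) -> uniq s -> r =i s -> r = seq_mset s.
Proof.
move=> r1 us rs; apply/msetP => t; rewrite mset_seqE count_uniq_mem // -rs.
by have := r1 t; rewrite -mset_gt0; case: (r t) => [|[]].
Qed.

Lemma count_memE (r : word) (s : seq var) : uniq s ->
  count [in s] (enum_mset r) = \sum_(t <- s) r t.
Proof.
elim: s => [|a s IH /= /andP[a_s us]]; first by rewrite big_nil count_pred0.
rewrite big_cons -IH // -count_mem_mset -count_predUI.
rewrite (@eq_count _ (predI _ _) pred0) ?count_pred0 ?addn0 => [|t /=].
  by apply: eq_count => t /=; rewrite inE.
by case: eqP => // ->; apply: negbTE.
Qed.

Section MultilinearTests.

Variables (u : {fset word}) (r : word).
Hypothesis u_linear : forall w : word, w \in u -> forall t, w t <= 1.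
Hypothesis Hur : satisfies H (u `|` [fset r]) u.

Lemma H_absorbed_linear t : r t <= 1.
Proof.
rewrite leqNgt; apply/negP; rewrite -count_mem_mset => /(H_absorbed_count Hur)[w wu].
by rewrite count_mem_mset ltnNge u_linear.
Qed.

(** In a linear word, two occurrences of letters from {[s], [t]} must be one of each. *)
Lemma H_absorbed_clique s t : s \in r -> t \in r -> s != t ->
  exists2 w : word, w \in u & (s \in w) && (t \in w).
Proof.
move=> sr tr st; have st2 : uniq [:: s; t] by rewrite /= inE st.
have [|w wu] := H_absorbed_count (A := [in [:: s; t]]) Hur.
  by rewrite count_memE // !big_cons big_nil -!mset_gt0 in sr tr *; lia.
rewrite count_memE // !big_cons big_nil => wst; exists w => //.
by have := u_linear wu s; have := u_linear wu t; rewrite -!mset_gt0; lia.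
Qed.

End MultilinearTests.

(** * Cyclic products and odd powers in G *)

Lemma big_iota_shift R (idx : R) (op : Monoid.com_law idx) (f : nat -> R) n :
  f n.+1 = f 1 ->
  \big[op / idx]_(i <- iota 1 n) f i.+1 = \big[op / idx]_(i <- iota 1 n) f i.
Proof.
case: n => [_|n fn]; first by rewrite !big_nil.
rewrite [in RHS]/= big_cons -(addn1 n) iotaD big_cat big_seq1 -fn.
by rewrite (iotaDl 1 1) big_map [RHS]Monoid.mulmC.
Qed.

Fact G_mul1 : left_id G_one G_mul. Proof. by case. Qed.

HB.instance Definition _ := Monoid.isComLaw.Build G G_one G_mul G_mulA G_mulC G_mul1.

(** Every element of [G] satisfies g^3 = g, so it equals each of its odd powers. *)
Lemma G_prod_odd (g : G) (s : seq nat) : odd (size s) ->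
  \big[G_mul / G_one]_(i <- s) g = g.
Proof.
rewrite big_const_seq count_predT => odd_s; rewrite -(odd_double_half (size s)) odd_s.
by elim: (_./2) => [|k IH]; [case: g|rewrite doubleS !addnS 2!iterS IH; case: g {IH}].
Qed.

(** * The words of U_n and cyclic indices *)

Section CyclicPolynomial.

Variables (n : nat) (x y : nat -> var) (z : var).
Let xs := [seq x i | i <- iota 1 n].
Let ys := [seq y i | i <- iota 1 n].

(** The successor on the cycle 1, ..., [n]. Writing [y i.+1] as [y (next i)] keeps indices in the
    range where distinct indices give distinct letters. *)
Definition next i := if i == n then 1 else i.+1.

(** Stated as a disjunction of linear facts, so that [lia] can reason about the cycle. *)
Lemma nextP i : 0 < i <= n -> i < n /\ next i = i.+1 \/ i = n /\ next i = 1.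
Proof. by rewrite /next; case: eqP; lia. Qed.

Lemma next_range i : 0 < i <= n -> 0 < next i <= n.
Proof. by move=> ni; have := nextP ni; lia. Qed.

Lemma mem_map_iota (f : nat -> var) i : 0 < i <= n -> f i \in [seq f i | i <- iota 1 n].
Proof. by move=> ni; apply: map_f; rewrite mem_iota; lia. Qed.

Lemma map_iotaP (f : nat -> var) t :
  reflect (exists2 i, 0 < i <= n & t = f i) (t \in [seq f i | i <- iota 1 n]).
Proof.
apply: (iffP mapP) => -[i ni ->]; exists i => //; move: ni; rewrite mem_iota; lia.
Qed.

Lemma eq_map_iota (f : nat -> var) i j : uniq [seq f i | i <- iota 1 n] ->
  0 < i <= n -> 0 < j <= n -> (f i == f j) = (i == j).
Proof.
(* Indices start at 1 and positions in a list at 0, hence the predecessors. *)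
move=> uf ni nj; have := @nth_uniq _ 0 _ i.-1 j.-1 _ _ uf.
rewrite !size_map size_iota !(nth_map 0) ?size_iota ?nth_iota; try lia.
by rewrite !add1n !prednK; try lia; move=> ->; lia.
Qed.

Local Notation p := (p_word n x).
Local Notation a := (a_word x z).
Local Notation b := (b_word x y z).
Local Notation q := (q_word n x z).

Lemma z_in_a : z \in a.
Proof. by rewrite in_seq_mset !inE eqxx orbT. Qed.

Lemma z_in_b j : z \in b j.
Proof. by rewrite in_seq_mset !inE eqxx !orbT. Qed.

Lemma in_UP (w : word) :
  reflect ([\/ w = p, w = a | exists2 i, 0 < i <= n & w = b i]) (w \in U n x y z).
Proof.
rewrite in_fsetU in_fset2; apply: (iffP idP).
  case/orP=> [/orP[]/eqP->|/imfsetP[i /= ni ->]]; [exact: Or31|exact: Or32|].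
  by apply: Or33; exists i => //; move: ni; rewrite mem_iota; lia.
case=> [->|->|[i ni ->]]; rewrite ?eqxx ?orbT //.
by apply/orP; right; apply/imfsetP; exists i => //=; rewrite mem_iota; lia.
Qed.

Lemma q_wordE : q = seq_mset (z :: xs).
Proof.
by apply/msetP => t; rewrite /q_word msetDC mset1DE !mset_seqE /= eq_sym.
Qed.

Lemma p_in_U : p \in U n x y z.
Proof. exact/in_UP/Or31. Qed.

Lemma a_in_U : a \in U n x y z.
Proof. exact/in_UP/Or32. Qed.

Lemma b_in_U i : 0 < i <= n -> b i \in U n x y z.
Proof. by move=> ni; apply/in_UP/Or33; exists i. Qed.

Lemma q_cword : is_cword q.
Proof. by apply: (cword_mem (t := z)); rewrite q_wordE in_seq_mset mem_head. Qed.

(** * U_n absorbs q_n in D, H and G *)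

Section AbsorptionOfQ.

Hypothesis n_gt0 : 0 < n.

Lemma U_cword (w : word) : w \in U n x y z -> is_cword w.
Proof.
case/in_UP=> [->|->|[i ni ->]].
- by apply: (cword_mem (t := x 1)); rewrite in_seq_mset mem_map_iota //; lia.
- exact: cword_mem z_in_a.
- exact: cword_mem (z_in_b i).
Qed.

Lemma U_polynomial : is_polynomial (U n x y z).
Proof. by apply: (is_polynomialP p_in_U) => w; apply: U_cword. Qed.

Lemma U_eval (S : comAISemiringType) (phi : var -> S) :
  exists c, eval phi (U n x y z) = Some c.
Proof. by have := eval_isSome phi U_polynomial; case: eval => // c _; exists c. Qed.

(** [q] is a multiple of [p], so in the lattice [D] its value lies below that of [p]. *)
Lemma D_absorbs_q : satisfies D (U n x y z `|` [fset q]) (U n x y z).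
Proof.
move=> phi; have [c Uc] := U_eval phi.
apply: (@eval_setU1_id D phi true c _ _ q_cword Uc).
have := @eval_upper D phi true c _ _ (U_cword p_in_U) p_in_U Uc.
rewrite q_wordE !(@weval_seq_unital D phi true) // big_cons.
by case: (phi z); case: c {Uc} => //; case: (\big[_/_]_(t <- xs) _).
Qed.

Lemma H_absorbs_q : satisfies H (U n x y z `|` [fset q]) (U n x y z).
Proof.
(* If z is sent to 1 then q_n has the value of p_n; otherwise, unless U_n has the value
   H_inf, the b_i force every x_i to 1, and q_n has the value of a_n. *)
move=> phi; have [c Uc] := U_eval phi.
apply: (@eval_setU1_id H phi H_one c _ _ q_cword Uc).
have Hp := @eval_upper H phi H_one c _ _ (U_cword p_in_U) p_in_U Uc.
have Ha := @eval_upper H phi H_one c _ _ (U_cword a_in_U) a_in_U Uc.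
have Hb i (ni : 0 < i <= n) :=
  @eval_upper H phi H_one c _ _ (U_cword (b_in_U ni)) (b_in_U ni) Uc.
have unit1 : left_id H_one H_mul by case.
rewrite q_wordE !(@weval_seq_unital H phi H_one) // in Hp Ha *.
rewrite !big_cons !big_nil in Ha *.
have [z1|zN1] : phi z = H_one \/ phi z <> H_one by case: (phi z); [left|right|right].
  by rewrite z1.
have [->|cN] : c = H_inf \/ c <> H_inf by case: (c); [right|right|left].
  by case: (@Defs.mul H _ _).
have x1 i : 0 < i <= n -> phi (x i) = H_one.
  move=> /Hb; rewrite (@weval_seq_unital H phi H_one) // !big_cons !big_nil.
  by case: (phi (x i)); case: (phi z) zN1; case: (c) cN => //;
    case: (phi (y i)); case: (phi (y i.+1)).
rewrite x1 in Ha; last by lia.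
rewrite big_map big_seq (@big_ind _ (fun h => h = H_one)) //.
- by move=> _ _ -> ->.
- by move=> i; rewrite mem_iota => ni; apply: x1; lia.
Qed.

Hypothesis n_odd : odd n.
Hypothesis y_cyclic : y n.+1 = y 1.

Lemma G_absorbs_q : satisfies G (U n x y z `|` [fset q]) (U n x y z).
Proof.
move=> phi; have [c Uc] := U_eval phi.
apply: (@eval_setU1_id G phi G_one c _ _ q_cword Uc).
have Gb i (ni : 0 < i <= n) :=
  @eval_upper G phi G_one c _ _ (U_cword (b_in_U ni)) (b_in_U ni) Uc.
rewrite q_wordE (@weval_seq_unital G phi G_one _ G_mul1) big_cons.
have [->|cN] : c = G_inf \/ c <> G_inf by case: (c); [right|right|left].
  by case: (@Defs.mul G _ _).
(* When [c] is not [G_inf], a sum in [G] has value [c] only if all its summands do. Hence every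
   [b i] has value [c], and the product of all [n] of them is [c] because [n] is odd. *)
have prod_b : \big[G_mul / G_one]_(i <- iota 1 n)
    G_mul (phi (x i)) (G_mul (phi (y i)) (G_mul (phi (y i.+1)) (phi z))) = c.
  rewrite -[RHS](G_prod_odd c (s := iota 1 n)) ?size_iota //.
  apply: eq_big_seq => i; rewrite mem_iota => ni.
  have {}ni : 0 < i <= n by lia.
  have := Gb i ni; rewrite (@weval_seq_unital G phi G_one _ G_mul1) !big_cons big_nil.
  rewrite -[Defs.mul (phi z) _]/(G_mul (phi z) G_one) [G_mul (phi z) _]G_mulC G_mul1.
  by rewrite -![@Defs.mul _ _ _]/(G_mul _ _); case: (G_mul _ _); case: (c) cN.
(* The factors [y i.+1] run once around the cycle, so the product of the [y i] appears squared,
   while the [n] factors [z] reduce to one. *)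
rewrite !big_split /= (big_iota_shift _ (f := fun i => phi (y i))) ?y_cyclic // in prod_b.
rewrite (G_prod_odd (phi z)) ?size_iota // in prod_b.
rewrite big_map -prod_b -[@Defs.mul _ _ _]/(G_mul _ _).
(* If the product of the [y i] is not [G_inf], its square is [G_one] and [q] has value [c];
   otherwise [c] is [G_inf], which absorbs everything. *)
by case: (\big[_/_]_(i <- iota 1 n) phi (x i));
  case: (\big[_/_]_(i <- iota 1 n) phi (y i)); case: (phi z).
Qed.

End AbsorptionOfQ.

(** * Distinct letters and their occurrences in the words of U_n *)

Hypothesis n_ge5 : 5 <= n.
Hypothesis xyz_uniq : uniq (z :: [seq x i | i <- iota 1 n] ++ [seq y i | i <- iota 1 n]).
Hypothesis y_cyclic : y n.+1 = y 1.

Lemma y_next i : 0 < i <= n -> y i.+1 = y (next i).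
Proof. by case/nextP=> [[_ ->]|[-> ->]]. Qed.

Lemma x_eq i j : 0 < i <= n -> 0 < j <= n -> (x i == x j) = (i == j).
Proof. by apply: eq_map_iota; move: xyz_uniq; rewrite /= cat_uniq => /and4P[]. Qed.

Lemma y_eq i j : 0 < i <= n -> 0 < j <= n -> (y i == y j) = (i == j).
Proof. by apply: eq_map_iota; move: xyz_uniq; rewrite /= cat_uniq => /and4P[]. Qed.

Lemma xy_neq i j : 0 < i <= n -> 0 < j <= n -> (x i == y j) = false.
Proof.
move=> ni nj; move: xyz_uniq; rewrite /= cat_uniq => /and4P[_ _ /hasPn xy _].
by apply/eqP => E; have := xy _ (mem_map_iota y nj); rewrite -E mem_map_iota.
Qed.

Lemma xz_neq i : 0 < i <= n -> (x i == z) = false.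
Proof.
move=> ni; move: xyz_uniq => /= /andP[]; rewrite mem_cat negb_or => /andP[zx _] _.
by apply/eqP => E; rewrite -E mem_map_iota in zx.
Qed.

Lemma yz_neq i : 0 < i <= n -> (y i == z) = false.
Proof.
move=> ni; move: xyz_uniq => /= /andP[]; rewrite mem_cat negb_or => /andP[_ zy] _.
by apply/eqP => E; rewrite -E mem_map_iota in zy.
Qed.

Lemma yx_neq i j : 0 < i <= n -> 0 < j <= n -> (y i == x j) = false.
Proof. by move=> ni nj; rewrite eq_sym xy_neq. Qed.

Lemma zx_neq i : 0 < i <= n -> (z == x i) = false.
Proof. by move=> ni; rewrite eq_sym xz_neq. Qed.

Lemma zy_neq i : 0 < i <= n -> (z == y i) = false.
Proof. by move=> ni; rewrite eq_sym yz_neq. Qed.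

Definition var_eqE := (x_eq, y_eq, xy_neq, yx_neq, xz_neq, yz_neq, zx_neq, zy_neq, eqxx).

Lemma x_in_p i : 0 < i <= n -> x i \in p.
Proof. by move=> ni; rewrite in_seq_mset mem_map_iota. Qed.

Lemma y_in_p i : 0 < i <= n -> (y i \in p) = false.
Proof.
by move=> ni; rewrite in_seq_mset; apply/map_iotaP => -[j nj /eqP]; rewrite yx_neq.
Qed.

Lemma z_in_p : (z \in p) = false.
Proof. by rewrite in_seq_mset; apply/map_iotaP => -[j nj /eqP]; rewrite zx_neq. Qed.

Lemma x_in_a i : 0 < i <= n -> (x i \in a) = (i == 1).
Proof. by move=> ni; rewrite in_seq_mset !inE !var_eqE ?orbF //; lia. Qed.

Lemma y_in_a i : 0 < i <= n -> (y i \in a) = false.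
Proof. by move=> ni; rewrite in_seq_mset !inE !var_eqE //; lia. Qed.

Lemma x_in_b i j : 0 < i <= n -> 0 < j <= n -> (x i \in b j) = (i == j).
Proof.
move=> ni nj; have ns := next_range nj.
by rewrite in_seq_mset !inE y_next // !var_eqE // !orbF.
Qed.

Lemma y_in_b i j : 0 < i <= n -> 0 < j <= n -> (y i \in b j) = (i == j) || (i == next j).
Proof.
move=> ni nj; have ns := next_range nj.
by rewrite in_seq_mset !inE y_next // !var_eqE // !orbF.
Qed.

Lemma zxs_uniq : uniq (z :: xs).
Proof. by move: xyz_uniq; rewrite -cat_cons cat_uniq => /and3P[]. Qed.

Lemma b_uniq i : 0 < i <= n -> uniq [:: x i; y i; y i.+1; z].
Proof.
move=> ni; have ns := next_range ni.
by rewrite y_next //= !inE !var_eqE //; have := nextP ni; lia.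
Qed.

Lemma U_linear (w : word) : w \in U n x y z -> forall t, w t <= 1.
Proof.
move=> wU; suff [s us ->] : exists2 s, uniq s & w = seq_mset s.
  by move=> t; rewrite mset_seqE count_uniq_mem // leq_b1.
case/in_UP: wU => [->|->|[i ni ->]].
- by exists xs => //; case/andP: zxs_uniq.
- by exists [:: x 1; z]; rewrite //= inE !var_eqE //; lia.
- by exists [:: x i; y i; y i.+1; z] => //; apply: b_uniq.
Qed.

(** * Words passing the tests of H and G, according to the word of U_n below them *)

Section WordAbsorbed.

Variable r : word.
Hypothesis r_linear : forall t, r t <= 1.
Hypothesis r_clique : forall s t, s \in r -> t \in r -> s != t ->
  exists2 w : word, w \in U n x y z & (s \in w) && (t \in w).
Hypothesis r_parity : forall A : pred var,
  (forall w : word, w \in U n x y z -> ~~ odd (count A (enum_mset w))) ->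
  ~~ odd (count A (enum_mset r)).

Lemma clique_xy i j : 0 < i <= n -> 0 < j <= n -> x i \in r -> y j \in r ->
  j = i \/ j = next i.
Proof.
move=> ni nj xr yr; have [|w /in_UP[->|->|[k nk ->]]] := r_clique xr yr.
- by rewrite xy_neq.
- by rewrite y_in_p // andbF.
- by rewrite y_in_a // andbF.
- by rewrite x_in_b // y_in_b // => /andP[/eqP-> /orP[]/eqP->]; [left|right].
Qed.

Lemma clique_yy i j : 0 < i <= n -> 0 < j <= n -> y i \in r -> y j \in r ->
  j = i \/ j = next i \/ i = next j.
Proof.
move=> ni nj yir yjr; have [<-|ij] := eqVneq i j; first by left.
have [|w /in_UP[->|->|[k nk ->]]] := r_clique yir yjr.
- by rewrite y_eq.
- by rewrite y_in_p.
- by rewrite y_in_a.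
- rewrite !y_in_b // => /andP[/orP[]/eqP ik /orP[]/eqP jk]; rewrite ik jk; tauto.
Qed.

(** The clique condition speaks of pairs of distinct letters, so a second letter of [r] is required
    to place [t] in a word of [U_n]. *)
Lemma clique_letters t : t \in r -> (exists2 s, s \in r & s != t) ->
  [\/ exists2 i, 0 < i <= n & t = x i, exists2 i, 0 < i <= n & t = y i | t = z].
Proof.
move=> tr [s sr st].
have [w /in_UP[->|->|[i ni ->]]] := r_clique sr tr st => /andP[_];
  rewrite in_seq_mset.
- by move=> /map_iotaP ?; exact: Or31.
- rewrite !inE => /orP[]/eqP->; last exact: Or33.
  by apply: Or31; exists 1 => //; lia.
- rewrite y_next // !inE => /or4P[]/eqP->; [|apply: Or32|apply: Or32|exact: Or33].
  + by apply: Or31; exists i.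
  + by exists i.
  + by exists (next i) => //; apply: next_range.
Qed.

(** A further [x i] would be joined to both [y j] and [y (next j)], which forces [i = j]. A further
    [y i] would complete a triangle in a cycle of length at least 5. *)
Lemma above_b j : 0 < j <= n -> {subset b j <= r} -> r = b j.
Proof.
move=> nj sub; have ns := next_range nj.
have [xr yr yr' zr] : [/\ x j \in r, y j \in r, y (next j) \in r & z \in r].
  by split; apply: sub; rewrite ?z_in_b ?x_in_b ?y_in_b ?eqxx ?orbT.
apply: eq_seq_mset => // [|t]; first exact: b_uniq.
rewrite -(in_seq_mset t [:: x j; y j; y j.+1; z]) -/(b j).
apply/idP/idP => [tr|]; last exact: sub.
have [|[i ni E]|[i ni E]|->] := clique_letters tr; subst; rewrite ?z_in_b //.
- have [<-|zt] := eqVneq z t; last by exists z.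
  by exists (x j); rewrite ?xz_neq.
- rewrite x_in_b //; have := clique_xy ni nj tr yr; have := clique_xy ni ns tr yr'.
  have := nextP ni; have := nextP nj; lia.
- rewrite y_in_b //; have := clique_yy ni nj tr yr; have := clique_yy ni ns tr yr'.
  have := nextP ni; have := nextP nj; have := nextP ns; lia.
Qed.

Lemma p_or_q : (forall i, 0 < i <= n -> x i \in r) ->
  (forall i, 0 < i <= n -> y i \notin r) -> r = p \/ r = q.
Proof.
move=> xsr noy.
have xr : x 1 \in r by apply: xsr; lia.
have lt t : t \in r -> t \in z :: xs.
  move=> tr; have [|[i ni E]|[i ni E]|->] := clique_letters tr;
    subst; rewrite ?inE ?eqxx //.
  (* The second letter is [x 1], or [x 2] if [t] is [x 1]. *)
  - have [<-|x1t] := eqVneq (x 1) t; last by exists (x 1).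
    by exists (x 2); [apply: xsr; lia|rewrite x_eq //; lia].
  - by rewrite mem_map_iota ?orbT.
  - by rewrite (negPf (noy i ni)) in tr.
have /andP[zxs uxs] := zxs_uniq.
have [zr|zr] := boolP (z \in r); [right; rewrite q_wordE|left];
  apply: eq_seq_mset; rewrite //= ?zxs // => t.
- apply/idP/idP => [/lt //|]; rewrite inE => /orP[/eqP->//|/map_iotaP[i ni ->]].
  exact: xsr.
- apply/idP/idP => [tr|/map_iotaP[i ni ->]]; last exact: xsr.
  by have := lt _ tr; rewrite inE => /orP[/eqP E|//]; rewrite -E tr in zr.
Qed.

Lemma above_p : {subset p <= r} -> r = p \/ r = q.
Proof.
move=> sub; have xr i : 0 < i <= n -> x i \in r by move=> ni; apply/sub/x_in_p.
apply: p_or_q => // i ni.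
apply/negP => yr.
(* A letter [y i] joined to [x 1] has [i] in {1, 2}, and one joined to [x 3] has [i] in {3, 4}. *)
have n1 : 0 < 1 <= n by lia.
have n3 : 0 < 3 <= n by lia.
have := clique_xy n1 ni (xr _ n1) yr; have := clique_xy n3 ni (xr _ n3) yr.
by have := nextP n1; have := nextP n3; lia.
Qed.

(** [p] and [a] contain no [y], and each [b i] contains exactly two. *)
Lemma parity_ys : ~~ odd (count [in ys] (enum_mset r)).
Proof.
have xN i : 0 < i <= n -> (x i \in ys) = false.
  by move=> ni; apply/map_iotaP => -[j nj /eqP]; rewrite xy_neq.
have zN : (z \in ys) = false by apply/map_iotaP => -[j nj /eqP]; rewrite zy_neq.
apply: r_parity => w /in_UP[->|->|[i ni ->]]; rewrite count_seq_mset.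
- rewrite (@eq_in_count _ _ pred0) ?count_pred0 // => t /map_iotaP[i ni ->].
  exact: xN.
- by rewrite /= xN ?zN //; lia.
- by have ns := next_range ni; rewrite y_next //= !mem_map_iota // xN // zN.
Qed.

(** The set [A] meets [p] in its two [x] letters, [b i] in [x i] and [y i.+1], [b i.+1] in [x i.+1]
    and [y i.+1], and no other [b j]. It misses [a] because [i > 1]. *)
Lemma parity_xxy i : 1 < i < n -> y i.+1 \notin r -> (x i.+1 \in r) = (x i \in r).
Proof.
move=> ni yr; have n0 : 0 < i <= n by lia.
have n1 : 0 < i.+1 <= n by lia.
pose A := [:: x i; x i.+1; y i.+1].
have uA : uniq A by rewrite /= !inE !var_eqE //; lia.
have : ~~ odd (count [in A] (enum_mset r)).
  apply: r_parity => w wU; have wl := U_linear wU.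
  rewrite count_memE // !big_cons big_nil.
  have wE t : w t = (t \in w) by have := wl t; rewrite -mset_gt0; case: (w t) => [|[]].
  rewrite !wE; case/in_UP: wU => [->|->|[j nj ->]].
  - by rewrite !x_in_p // y_in_p.
  - by rewrite !x_in_a // y_in_a //; lia.
  - rewrite !x_in_b // y_in_b //; have := nextP nj; lia.
rewrite count_memE // !big_cons big_nil -!mset_gt0 in yr *.
have := r_linear (x i); have := r_linear (x i.+1); lia.
Qed.

Lemma above_a : {subset a <= r} -> [\/ r = a, r = b 1 | r = q].
Proof.
move=> sub; have n1 : 0 < 1 <= n by lia.
have xr : x 1 \in r by apply: sub; rewrite x_in_a.
have zr : z \in r by apply: sub; rewrite z_in_a.
have y12 i : 0 < i <= n -> y i \in r -> i = 1 \/ i = 2.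
  by move=> ni /(clique_xy n1 ni xr); have := nextP n1; lia.
(* A [y] that is alone in [r] contradicts [parity_ys]. With [y12], either both [y 1] and [y 2]
   occur, so that [r] lies above [b 1], or no [y] does. *)
have one_y i : 0 < i <= n -> y i \in r ->
    (forall j, 0 < j <= n -> y j \in r -> j = i) -> False.
  move=> ni yr only; have := parity_ys.
  rewrite (@eq_in_count _ _ (pred1 (y i))) ?count_mem_mset.
    by have := r_linear (y i); rewrite -mset_gt0 in yr; lia.
  move=> t tr; apply/map_iotaP/eqP => [[j nj E]|->]; last by exists i.
  by rewrite E (only j) // -E.
have [/andP[y1 y2]|] := boolP ((y 1 \in r) && (y 2 \in r)).
  apply: Or32; apply: above_b => // t; rewrite in_seq_mset !inE.
  by case/or4P=> /eqP->.
rewrite negb_and => y1y2.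
have noy i : 0 < i <= n -> y i \notin r.
  move=> ni; apply/negP => yr; apply: (one_y i ni yr) => j nj yjr.
  by case: (y12 _ ni yr) (y12 _ nj yjr) => Ei [] Ej; subst; rewrite ?yr ?yjr in y1y2 *.
have xsr i : 2 <= i <= n -> (x i \in r) = (x 2 \in r).
  elim: i => [|i IH] ni; first by lia.
  (* The induction effectively starts at index 2, where the claim is trivial; [parity_xxy] applies
     from there on. *)
  have [->//|i1] := eqVneq i 1.
  by rewrite parity_xxy ?IH ?noy //; lia.
have [x2|x2] := boolP (x 2 \in r).
  have xs_r i : 0 < i <= n -> x i \in r.
    by move=> ni; have [->//|i1] := eqVneq i 1; rewrite xsr //; lia.
  case: (p_or_q xs_r noy) => [E|->]; last exact: Or33.
  by rewrite E z_in_p in zr.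
apply: Or31; apply: eq_seq_mset => // [|t]; first by rewrite /= inE xz_neq.
apply/idP/idP => [tr|]; last by rewrite -in_seq_mset; apply: sub.
have [|[i ni E]|[i ni E]|->] := clique_letters tr; subst; rewrite ?inE ?eqxx ?orbT //.
- have [<-|zt] := eqVneq z t; last by exists z.
  by exists (x 1); rewrite ?xz_neq.
- have [->|i1] := eqVneq i 1; first by rewrite eqxx.
  by rewrite xsr ?(negPf x2) in tr; lia.
- by rewrite (negPf (noy i ni)) in tr.
Qed.

End WordAbsorbed.

(** * Absorbed words and the equivalence class of U_n *)

Lemma absorbed_word (r : word) : is_cword r ->
  satisfies D (U n x y z `|` [fset r]) (U n x y z) ->
  satisfies H (U n x y z `|` [fset r]) (U n x y z) ->
  satisfies G (U n x y z `|` [fset r]) (U n x y z) ->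
  r \in U n x y z `|` [fset q].
Proof.
move=> r0 Dr Hr Gr.
have lin := H_absorbed_linear U_linear Hr.
have clique := H_absorbed_clique U_linear Hr.
rewrite in_fsetU1_r.
have [w /in_UP[->|->|[i ni ->]] sub] := D_absorbed_sub r0 Dr.
- by case: (above_p lin clique sub) => ->; rewrite ?p_in_U ?eqxx ?orbT.
- case: (above_a lin clique (fun A => G_absorbed_even Gr) sub) => ->;
    by rewrite ?a_in_U ?b_in_U ?eqxx ?orbT //; lia.
- by rewrite (above_b lin clique ni sub) b_in_U.
Qed.

(** It suffices that every word of [U_n] lies in [v]. By [D], [v] has a word with letters in [p],
    which is [p] since the other candidates contain [z], and one with letters in [a], which is [a]
    since the others contain [x 2] or some [y i]. By [H], [y i] and [y (next i)] share a word of
    [v], and only [b i] contains both. *)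
Lemma equivalent_polynomial (v : {fset word}) :
  (forall w : word, w \in v -> w \in U n x y z `|` [fset q]) ->
  (forall w : word, w \in U n x y z -> satisfies D (v `|` [fset w]) v) ->
  (forall w : word, w \in U n x y z -> satisfies H (v `|` [fset w]) v) ->
  v = U n x y z \/ v = U n x y z `|` [fset q].
Proof.
move=> sub Dv Hv.
have n2 : 0 < 2 <= n by lia.
have n0 : 0 < n by lia.
have vP w : w \in v -> [\/ w = p, w = a, exists2 i, 0 < i <= n & w = b i | w = q].
  move/sub; rewrite in_fsetU1_r => /orP[/in_UP[->|->|bw]|/eqP->].
  - exact: Or41.
  - exact: Or42.
  - exact: Or43.
  - exact: Or44.
have in_q t : (t \in q) = (t == z) || (t \in p) by rewrite q_wordE !in_seq_mset inE.
have v_linear (w : word) : w \in v -> forall t, w t <= 1.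
  move/sub; rewrite in_fsetU1_r => /orP[/U_linear//|/eqP-> t].
  by rewrite q_wordE mset_seqE count_uniq_mem ?leq_b1 // zxs_uniq.
have Uv (w : word) : w \in U n x y z -> w \in v.
  move=> wU; case/in_UP: (wU) => [E|E|[i ni E]].
  - have [w' w'v sw'] := D_absorbed_sub (U_cword n0 wU) (Dv w wU).
    case/vP: (w'v) => [E'|E'|[i ni E']|E']; first by rewrite E -E'.
    + by have := sw' z; rewrite E E' z_in_a z_in_p => /(_ isT).
    + by have := sw' z; rewrite E E' z_in_b z_in_p => /(_ isT).
    + by have := sw' z; rewrite E E' in_q eqxx z_in_p => /(_ isT).
  - have [w' w'v sw'] := D_absorbed_sub (U_cword n0 wU) (Dv w wU).
    case/vP: (w'v) => [E'|E'|[i ni E']|E']; last 1 first.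
    + by have := sw' (x 2); rewrite E E' in_q x_in_p ?x_in_a ?orbT // => /(_ isT).
    + by have := sw' (x 2); rewrite E E' x_in_p ?x_in_a // => /(_ isT).
    + by rewrite E -E'.
    + by have := sw' (y i); rewrite E E' y_in_b ?y_in_a ?eqxx // => /(_ isT).
  - have ns := next_range ni; have := nextP ni => ni'.
    have [|||w' w'v] := @H_absorbed_clique v w v_linear (Hv w wU) (y i) (y (next i)).
    + by rewrite E y_in_b // eqxx.
    + by rewrite E y_in_b // eqxx orbT.
    + by rewrite y_eq //; lia.
    case/vP: (w'v) => [E'|E'|[k nk E']|E']; rewrite E'.
    + by rewrite y_in_p.
    + by rewrite y_in_a.
    + rewrite !y_in_b //; have := nextP nk => nk' ik.
      by rewrite E (_ : i = k) -?E' //; lia.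
    + by rewrite !in_q yz_neq ?y_in_p.
have [qv|qv] := boolP (q \in v); [right|left]; apply/fsetP => w; apply/idP/idP.
- exact: sub.
- by rewrite in_fsetU1_r => /orP[/Uv|/eqP->].
- move=> wv; have := sub w wv; rewrite in_fsetU1_r => /orP[//|/eqP wq].
  by rewrite -wq wv in qv.
- exact: Uv.
Qed.

End CyclicPolynomial.

Theorem lemma5p1 (n : nat) (x y : nat -> var) (z : var) :
  5 <= n -> odd n ->
  uniq (z :: [seq x i | i <- iota 1 n] ++ [seq y i | i <- iota 1 n]) ->
  y n.+1 = y 1 ->
  (forall r : word, is_cword r ->
     class_satisfies W (U n x y z `|` [fset r]) (U n x y z) ->
     [\/ r = p_word n x, r = a_word x z,
         (exists2 i : nat, 1 <= i <= n & r = b_word x y z i)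
       | r = q_word n x z]) /\
  (forall v : {fset word}, is_polynomial v ->
     (class_satisfies W v (U n x y z) <->
        v = U n x y z \/ v = U n x y z `|` [fset q_word n x z])).
Proof.
move=> n5 n_odd xyz_uniq y_cyclic.
have n_gt0 : 0 < n by lia.
have U_poly := U_polynomial x y z n_gt0.
have poly_add (u : {fset word}) r : is_polynomial u -> is_cword r ->
    is_polynomial (u `|` [fset r]).
  move=> /andP[_ /forallP uP] r0; apply: (is_polynomialP (w := r)).
    by rewrite !inE eqxx orbT.
  move=> w; rewrite !inE => /orP[wu|/eqP->//]; exact: (uP [` wu]).
have absorbed r : is_cword r ->
    class_satisfies W (U n x y z `|` [fset r]) (U n x y z) ->
    r \in U n x y z `|` [fset q_word n x z].
  move=> r0 /W_satisfies[]; [exact: poly_add|exact: U_poly|].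
  exact: absorbed_word.
split=> [r r0 /absorbed|v v_poly].
  rewrite in_fsetU1_r => /(_ r0) /orP[/in_UP[->|->|br]|/eqP->].
  - exact: Or41.
  - exact: Or42.
  - exact: Or43.
  - exact: Or44.
split=> [vU|[->//|->]].
  (* A polynomial absorbs its own words. As [v] and [U_n] agree throughout [W], each also absorbs
     the words of the other. *)
  apply: equivalent_polynomial => // w w_in.
  - apply: absorbed => [|S WS phi].
      by case/andP: v_poly => _ /forallP /(_ [` w_in]).
    by rewrite eval_setU1 -(vU S WS phi) eval_absorb.
  - have [Dv _ _] := (W_satisfies v_poly U_poly).1 vU.
    by move=> phi; rewrite eval_setU1 Dv eval_absorb.
  - have [_ Hv _] := (W_satisfies v_poly U_poly).1 vU.
    by move=> phi; rewrite eval_setU1 Hv eval_absorb.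
apply/W_satisfies => //; first by apply: poly_add => //; apply: q_cword.
by split; [apply: D_absorbs_q|apply: H_absorbs_q|apply: G_absorbs_q].
Qed.
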